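(* As $x\to\infty$, $$\sum_{r\le x}N_2(1,r)=\frac{5}{8G}\,x^2+O(x\log x).$$
   Context: For $r\in\mathbb{N}=\{1,2,\ldots\}$, $N_2(1,r)$ is the number of solutions $(x,y)\in(\mathbb{Z}/r\mathbb{Z})^2$ of $x^2+y^2\equiv 1\pmod r$. The sum runs over all positive integers $r\le x$. $G=\sum_{n=0}^{\infty}\frac{(-1)^n}{(2n+1)^2}$ is the Catalan constant. *)

(* Defs.v *)
From mathcomp Require Import all_boot all_order all_algebra.
From mathcomp Require Import all_classical all_reals all_analysis.
Import Order.TTheory GRing.Theory Num.Theory.
Import numFieldNormedType.Exports.

Set Implicit Arguments.
Unset Strict Implicit.
Unset Printing Implicit Defensive.

Local Open Scope classical_set_scope.
Local Open Scope ring_scope.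

(* Residue classes modulo r are represented by 'I_r rather than by 'Z_r, since
   'Z_1 has two elements. *)
Definition N2 (m r : nat) : nat :=
  #|finset (fun p : 'I_r * 'I_r => (p.1 ^ 2 + p.2 ^ 2 == m %[mod r])%N)|.

Definition catalan (R : realType) : R :=
  limn (series (fun n : nat => (-1) ^+ n / (2 * n + 1)%:R ^+ 2 : R)).

(* For x >= 0, Num.truncn x is the integer part of x, so that r ranges over the
   positive integers r <= x. *)
Definition sum_N2 (R : realType) (m : nat) (x : R) : R :=
  (\sum_(1 <= r < (Num.truncn x).+1) N2 m r)%:R.

(* Lets the Landau notations be used at +oo. *)
Canonical pinfty_nbhs_filter_on (R : numFieldType) :=
  FilterType (@pinfty_nbhs R) (@filter_filter _ _ (@proper_pinfty_nbhs R)).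

(* Main.v *)
Require Import Defs.
From mathcomp Require Import all_boot all_order all_algebra all_field.
From mathcomp Require Import all_classical all_reals all_analysis.
From mathcomp Require Import zify ring lra.
Import Order.TTheory GRing.Theory Num.Theory.
Import numFieldNormedType.Exports.

Set Implicit Arguments.
Unset Strict Implicit.

Local Open Scope ring_scope.

(* Let [chi] be the nontrivial character modulo 4 and [f] its Dirichlet inverse.
   Counting solutions modulo primes (rational parametrization of the circle),
   lifting to prime powers and the Chinese remainder theorem give
   [N_2(1, r) = c(r) g(r)], where [g = f * id] and [c(r)] is [2] if [4 | r] and
   [1] otherwise.  As [g(4 s) = 4 g(s)], the sum is [S(x) + 4 S(x / 4)] for
   [S(x) = sum_{r <= x} g(r) = x^2 / 2 * sum_{d <= x} f(d) / d^2 + O(x log x)].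
   Finally [1 = sum_{d <= x} f(d) / d^2 * sum_{n <= x / d} chi(n) / n^2], and the
   alternating inner sum is [G + O(d^2 / x^2)], so that
   [sum_{d <= x} f(d) / d^2 = 1 / G + O(1 / x)].  The leading coefficient is thus
   [1 / (2 G) * (1 + 4 / 16) = 5 / (8 G)]. *)

(** * Multiplicative functions, divisor sums and Dirichlet convolution *)

Definition arith_multiplicative (R : comNzRingType) (f : nat -> R) :=
  f 1%N = 1 /\
  forall m n, (0 < m)%N -> (0 < n)%N -> coprime m n -> f (m * n)%N = f m * f n.

(** Strong induction: the full power of the least prime factor of [n] is coprime to its cofactor,
    which is smaller than [n]. *)
Lemma multiplicative_ext (R : comNzRingType) (f g : nat -> R) :
    arith_multiplicative f -> arith_multiplicative g ->
    (forall p k, prime p -> (0 < k)%N -> f (p ^ k)%N = g (p ^ k)%N) ->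
  forall n, (0 < n)%N -> f n = g n.
Proof.
move=> [f1 fM] [g1 gM] fg n; elim/ltn_ind: n => n IHn n_gt0.
have [n_gt1|n_le1] := ltnP 1 n; last first.
  by have -> : n = 1%N; [lia | rewrite f1 g1].
set p := pdiv n; have p_pr : prime p by exact: pdiv_prime.
have k_gt0 : (0 < logn p n)%N by rewrite logn_gt0 mem_primes p_pr n_gt0 pdiv_dvd.
have nE := partnC p n_gt0; have co := coprime_partC p n n.
have m_gt0 : (0 < n`_p^')%N by exact: part_gt0.
rewrite -nE fM ?part_gt0 // gM ?part_gt0 // p_part fg // IHn //.
rewrite -[ltnRHS]nE p_part ltn_Pmull //.
by rewrite -[1%N](expn0 p) ltn_exp2l ?prime_gt1.
Qed.

Definition euler_prod (R : comNzRingType) (h : nat -> nat -> R) (n : nat) : R :=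
  \prod_(p <- primes n) h p (logn p n).

Lemma euler_prod_multiplicative (R : comNzRingType) (h : nat -> nat -> R) :
  arith_multiplicative (euler_prod h).
Proof.
split=> [|m n m_gt0 n_gt0 co]; first by rewrite /euler_prod big_nil.
have disj : ~~ has (mem (primes m)) (primes n) by rewrite -coprime_has_primes.
have pe : perm_eq (primes (m * n)) (primes m ++ primes n).
  apply: uniq_perm; rewrite ?primes_uniq //.
    by rewrite cat_uniq !primes_uniq disj.
  by move=> p; rewrite primesM // mem_cat.
rewrite /euler_prod (perm_big _ pe) big_cat /=; congr (_ * _).
  apply: eq_big_seq => p pm; rewrite lognM // [X in (_ + X)%N](_ : _ = 0%N) ?addn0 //.
  apply/eqP; rewrite -leqn0 leqNgt logn_gt0; apply/negP => pn.
  by move/hasPn: disj => /(_ p pn) /negP; apply.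
apply: eq_big_seq => p pn; rewrite lognM // [X in (X + _)%N](_ : _ = 0%N) //.
apply/eqP; rewrite -leqn0 leqNgt logn_gt0; apply/negP => pm.
by move/hasPn: disj => /(_ p pn) /negP; apply.
Qed.

Lemma euler_prod_pfactor (R : comNzRingType) (h : nat -> nat -> R) p k :
  prime p -> (0 < k)%N -> euler_prod h (p ^ k) = h p k.
Proof.
by move=> pp k0; rewrite /euler_prod primesX // primes_prime // big_seq1 pfactorK.
Qed.

Definition dirichlet (R : comNzRingType) (f g : nat -> R) (n : nat) : R :=
  \sum_(d <- divisors n) f d * g (n %/ d)%N.

(** The inverse of [(a, b) |-> a * b] is [d |-> (gcdn d m, gcdn d n)]. *)
Lemma divisorsM m n : (0 < m)%N -> (0 < n)%N -> coprime m n ->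
  perm_eq (divisors (m * n)) [seq (a * b)%N | a <- divisors m, b <- divisors n].
Proof.
move=> m0 n0 co; have mn0 : (0 < m * n)%N by rewrite muln_gt0 m0.
apply: uniq_perm; first exact: divisors_uniq.
  apply: allpairs_uniq; rewrite ?divisors_uniq // => -[a b] [c d] /=.
  case/allpairsP => -[a' b'] /= [+ + [-> ->]]; rewrite -!dvdn_divisors // => am bn.
  case/allpairsP => -[c' d'] /= [+ + [-> ->]]; rewrite -!dvdn_divisors // => cm dn.
  have key x y : (x %| m)%N -> (y %| n)%N -> gcdn (x * y) m = x.
    move=> xm yn; rewrite gcdnC Gauss_gcdl ?(coprime_dvdr yn) //; exact/gcdn_idPr.
  move=> eq; have eac : a' = c' by rewrite -(key a' b') // eq key.
  move: eq; rewrite eac => /eqP; rewrite eqn_pmul2l ?(dvdn_gt0 m0) // => /eqP -> //.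
move=> d; rewrite -dvdn_divisors //; apply/idP/allpairsP => [dmn|].
  exists (gcdn d m, gcdn d n); rewrite /= -!dvdn_divisors // !dvdn_gcdr; split => //.
  apply/eqP; rewrite eqn_dvd; apply/andP; split.
    by rewrite muln_gcdr !muln_gcdl !dvdn_gcd dvdn_mull // dvdn_mull //= dvdn_mulr.
  rewrite Gauss_dvd ?dvdn_gcdl //.
  by apply: coprime_dvdl (dvdn_gcdr _ _) _; apply: coprime_dvdr (dvdn_gcdr _ _) _.
case=> -[a b] /= []; rewrite -!dvdn_divisors // => am bn ->; exact: dvdn_mul.
Qed.

Lemma dirichlet_multiplicative (R : comNzRingType) (f g : nat -> R) :
  arith_multiplicative f -> arith_multiplicative g -> arith_multiplicative (dirichlet f g).
Proof.
move=> [f1 fM] [g1 gM]; split=> [|m n m0 n0 co].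
  by rewrite /dirichlet big_seq1 f1 g1 mulr1.
rewrite /dirichlet (perm_big _ (divisorsM m0 n0 co)) big_allpairs_dep /=.
rewrite mulr_suml; apply: eq_big_seq => a; rewrite -dvdn_divisors // => am.
rewrite mulr_sumr; apply: eq_big_seq => b; rewrite -dvdn_divisors // => bn.
have a0 := dvdn_gt0 m0 am; have b0 := dvdn_gt0 n0 bn.
have/divnK <- := am; have/divnK <- := bn.
rewrite mulnACA !mulnK ?muln_gt0 ?a0 //.
have coab : coprime a b by exact: coprime_dvdl am (coprime_dvdr bn co).
have coq : coprime (m %/ a) (n %/ b).
  apply: coprime_dvdl (coprime_dvdr _ co); apply/dvdnP.
    by exists a; rewrite mulnC divnK.
  by exists b; rewrite mulnC divnK.
by rewrite fM // gM ?divn_gt0 // ?(dvdn_leq m0) ?(dvdn_leq n0) //; ring.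
Qed.

Lemma dirichlet_pfactor (R : comNzRingType) (f g : nat -> R) p k : prime p ->
  dirichlet f g (p ^ k) = \sum_(i < k.+1) f (p ^ i)%N * g (p ^ (k - i))%N.
Proof.
move=> pp; have pk0 : (0 < p ^ k)%N by rewrite expn_gt0 prime_gt0.
have pe : perm_eq (divisors (p ^ k)) [seq (p ^ i)%N | i <- iota 0 k.+1].
  apply: uniq_perm; first exact: divisors_uniq.
    rewrite map_inj_uniq ?iota_uniq //; apply: expnI; exact: prime_gt1.
  move=> d; rewrite -dvdn_divisors //; apply/(dvdn_pfactor _ _ pp)/mapP => -[i].
    by move=> ik ->; exists i; rewrite ?mem_iota.
  by rewrite mem_iota => ik ->; exists i.
rewrite /dirichlet (perm_big _ pe) big_map -[iota _ _]/(index_iota 0 k.+1) big_mkord.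
apply: eq_bigr => i _; rewrite -expnB ?prime_gt0 // -ltnS; exact: ltn_ord.
Qed.

(** Both sides run over the pairs [(d, m)] with [d * m <= M]. Passing from [M] to [M.+1] lengthens
    the inner range on the right by one exactly when [d] divides [M.+1]. *)
Lemma sum_divisors_hyperbola (V : nmodType) (F : nat -> nat -> V) M :
  \sum_(1 <= n < M.+1) \sum_(d <- divisors n) F d (n %/ d)%N =
  \sum_(1 <= d < M.+1) \sum_(1 <= m < (M %/ d).+1) F d m.
Proof.
elim: M => [|M IHM]; first by rewrite !big_nil.
rewrite big_nat_recr //= IHM [RHS]big_nat_recr //= divnn /= big_nat1.
have -> : \sum_(d <- divisors M.+1) F d (M.+1 %/ d)%N =
          \sum_(1 <= d < M.+2 | (d %| M.+1)%N) F d (M.+1 %/ d)%N.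
  rewrite -[RHS]big_filter; apply: perm_big; apply: uniq_perm.
  - exact: divisors_uniq.
  - by rewrite filter_uniq ?iota_uniq.
  - move=> d; rewrite -dvdn_divisors // mem_filter mem_index_iota.
    case dM : (d %| M.+1)%N => //=.
    by have := dvdn_leq (ltn0Sn M) dM; have := dvdn_gt0 (ltn0Sn M) dM; lia.
rewrite [X in _ + X]big_mkcond [X in _ + X]big_nat_recr //= dvdnn divnn /= addrA; congr (_ + _).
rewrite -big_split /=; apply: eq_big_nat => d /andP[d0 dM].
rewrite divnS //; case: ifP => dv /=; last by rewrite addr0.
by rewrite dv add1n [RHS]big_nat_recr.
Qed.

(** * The character modulo 4 and its Dirichlet inverse *)

Definition chi4 (n : nat) : int := if odd n then (-1) ^+ n./2 else 0.

Lemma chi4M m n : chi4 (m * n) = chi4 m * chi4 n.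
Proof.
rewrite /chi4 oddM; case m_odd: (odd m); last by rewrite mul0r.
case n_odd: (odd n) => /=; last by rewrite mulr0.
rewrite -signr_odd -exprD -[in RHS]signr_odd; congr (_ ^+ nat_of_bool _).
by rewrite -[m in LHS]odd_double_half -[n in LHS]odd_double_half m_odd n_odd; lia.
Qed.

Lemma chi4_multiplicative : arith_multiplicative chi4.
Proof. by split=> // m n _ _ _; exact: chi4M. Qed.

Lemma chi4X p k : chi4 (p ^ k) = chi4 p ^+ k.
Proof. by elim: k => // k IHk; rewrite expnS exprS chi4M IHk. Qed.

Lemma normr_chi4_le1 n : `|chi4 n| <= 1.
Proof. by rewrite /chi4; case: ifP => // _; rewrite normrX normrN1 expr1n. Qed.

(** The complete multiplicativity of [chi4] gives it the local series [1 / (1 - chi4 p * X)]; the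
    values prescribed here are the coefficients of the reciprocal. On positive integers this is the
    Moebius function times [chi4]. *)
Definition chi4_inv : nat -> int :=
  euler_prod (fun p k => if k == 1%N then - chi4 p else 0).

Lemma chi4_inv_multiplicative : arith_multiplicative chi4_inv.
Proof. exact: euler_prod_multiplicative. Qed.

Lemma chi4_inv_pfactor p k : prime p ->
  chi4_inv (p ^ k) = (if k == 0%N then 1 else if k == 1%N then - chi4 p else 0).
Proof.
case: k => [|k] pp; first by rewrite /chi4_inv /euler_prod big_nil.
by rewrite /chi4_inv euler_prod_pfactor.
Qed.

Lemma normr_chi4_inv_le1 n : `|chi4_inv n| <= 1.
Proof.
rewrite /chi4_inv /euler_prod normr_prod; apply: prodr_ile1 => p _.
rewrite normr_ge0 /=; case: ifP => _; last by rewrite normr0.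
by rewrite normrN normr_chi4_le1.
Qed.

Lemma dirichlet_chi4_inv_pfactor (g : nat -> int) p k : prime p ->
  dirichlet chi4_inv g (p ^ k.+1) = g (p ^ k.+1)%N - chi4 p * g (p ^ k)%N.
Proof.
move=> pp; rewrite dirichlet_pfactor // !big_ord_recl big1 => [|i _].
  by rewrite !chi4_inv_pfactor //= addr0 mul1r mulNr subn0 subn1.
by rewrite chi4_inv_pfactor //= mul0r.
Qed.

Lemma dirichlet_chi4_inv n : (0 < n)%N ->
  dirichlet chi4_inv chi4 n = (n == 1%N)%:R.
Proof.
have delta_mul : arith_multiplicative (fun n => (n == 1%N)%:R : int).
  split=> // m k m0 k0 _; rewrite muln_eq1.
  by case: eqP; case: eqP; rewrite ?mul0r ?mulr0 ?mulr1.
apply: (multiplicative_ext _ delta_mul).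
  exact: dirichlet_multiplicative chi4_inv_multiplicative chi4_multiplicative.
move=> p [//|k] pp _; rewrite dirichlet_chi4_inv_pfactor // !chi4X exprS subrr.
by rewrite expnS muln_eq1 eqn_leq leqNgt prime_gt1.
Qed.

(** * The multiplicative function [g = f * id] *)

Definition circle_count : nat -> int :=
  dirichlet chi4_inv (fun n => n%:R).

Lemma circle_count_multiplicative : arith_multiplicative circle_count.
Proof.
apply: dirichlet_multiplicative chi4_inv_multiplicative _.
by split=> // m n _ _ _; rewrite natrM.
Qed.

Lemma circle_count_pfactor p k : prime p ->
  circle_count (p ^ k.+1) = (p ^ k)%:R * (p%:R - chi4 p).
Proof.
move=> pp; rewrite /circle_count dirichlet_chi4_inv_pfactor // expnS natrM.
by rewrite mulrBr mulrC [chi4 p * _]mulrC.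
Qed.

(** Since [chi4 2 = 0], the local factor at 2 is that of the identity. *)
Lemma circle_count_pow2 a m : odd m ->
  circle_count (2 ^ a * m) = (2 ^ a)%:R * circle_count m.
Proof.
move=> om; have m0 : (0 < m)%N by case: m om.
rewrite (proj2 circle_count_multiplicative) ?expn_gt0 ?coprimeXl ?coprime2n //.
case: a => [|a]; first by rewrite (proj1 circle_count_multiplicative).
by rewrite circle_count_pfactor // subr0 -natrM expnSr.
Qed.

Lemma circle_count4 n : (0 < n)%N -> circle_count (4 * n) = 4 * circle_count n.
Proof.
move=> n0; have [m] := pfactor_coprime (isT : prime 2) n0.
rewrite coprime2n => om ->; rewrite mulnC [(m * _)%N]mulnC.
rewrite (_ : 2 ^ logn 2 n * m * 4 = 2 ^ (logn 2 n).+2 * m)%N; last first.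
  by rewrite !expnS; ring.
by rewrite !circle_count_pow2 // !expnS !natrM; ring.
Qed.

(** * Points of the unit circle over a finite field *)

(** The line of slope [t] through [(-1, 0)] meets the circle in one further point [h t], unless
    [t ^+ 2 = -1]. Every point other than [(-1, 0)] arises once, so adding [(-1, 0)] and the
    excluded slopes gives [#|F| + 1]. *)
Lemma card_circle_finField (F : finFieldType) : (2 : F) != 0 ->
  (#|[pred p : F * F | (p.1 ^+ 2 + p.2 ^+ 2 == 1)%R]| +
   #|[pred t : F | (t ^+ 2 == -1)%R]|)%N = #|F|.+1.
Proof.
move=> two0.
pose h (t : F) := ((1 - t ^+ 2) / (1 + t ^+ 2), (t *+ 2) / (1 + t ^+ 2)).
pose T := finset (fun t : F => t ^+ 2 != -1).
have T0 t : t \in T -> 1 + t ^+ 2 != 0 by rewrite inE addrC addr_eq0.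
have hx t : t \in T -> 1 + (h t).1 = 2 / (1 + t ^+ 2).
  by move=> /T0 t0 /=; field.
(* The slope is recovered as [y / (1 + x)], which gives injectivity here and surjectivity below. *)
have hinv t : t \in T -> (h t).2 / (1 + (h t).1) = t.
  by move=> tT; rewrite hx //=; field; rewrite two0 T0.
have -> : #|[pred p : F * F | p.1 ^+ 2 + p.2 ^+ 2 == 1]| =
          #|(-1, 0) |: imset h (mem T)|.
  apply: eq_card => -[x y]; rewrite !inE /= xpair_eqE.
  apply/idP/idP => [/eqP C|/orP[/andP[/eqP -> /eqP ->]|/imsetP[t /T0 t0 [-> ->]]]].
  - have [x1|x1] := eqVneq x (-1).
      by move: C; rewrite x1 sqrrN expr1n => /eqP; rewrite addrC -subr_eq0 addrK sqrf_eq0 => ->.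
    have x0 : 1 + x != 0 by rewrite addrC addr_eq0.
    have e : 1 + (y / (1 + x)) ^+ 2 = 2 / (1 + x).
      have -> : 1 + (y / (1 + x)) ^+ 2 = (1 + x *+ 2 + (x ^+ 2 + y ^+ 2)) / (1 + x) ^+ 2.
        by field.
      by rewrite C; field.
    apply/orP; right; apply/imsetP; exists (y / (1 + x)).
      by rewrite !inE -addr_eq0 addrC e mulf_neq0 // invr_eq0.
    rewrite /h e; congr (_, _); last by field; rewrite x0.
    have -> : 1 - (y / (1 + x)) ^+ 2 = 2 - (1 + (y / (1 + x)) ^+ 2) by ring.
    by rewrite e; field; rewrite x0.
  - by apply/eqP; ring.
  - by apply/eqP; field.
rewrite cardsU1 card_in_imset; last by move=> s t sT tT e; rewrite -(hinv _ sT) e hinv.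
have -> : (-1, 0) \notin imset h (mem T).
  apply/imsetP => -[t tT e]; move: (hx _ tT); rewrite -e /= subrr => /esym/eqP.
  by rewrite mulf_eq0 invr_eq0 (negPf two0) (negPf (T0 _ tT)).
have -> : #|[pred t : F | t ^+ 2 == -1]| = #|~: T|.
  by apply: eq_card => t; rewrite !inE negbK.
by rewrite add1n addSn cardsC.
Qed.

(** Euler's criterion: with [n = (#|F| - 1) / 2], the element [-1] is a square exactly when [n] is
    even, and it then has two square roots. *)
Lemma card_sqrtN1_finField (F : finFieldType) : odd #|F| -> (2 : F) != 0 ->
  #|[pred t : F | (t ^+ 2 == -1)]|%:Z = 1 + chi4 #|F|.
Proof.
move=> oF two0.
have F1 : (1 < #|F|)%N by exact: finNzRing_gt1.
have FE : #|F| = (#|F|./2.*2).+1 by rewrite -[LHS]odd_double_half oF.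
set n := #|F|./2 in FE *.
have n0 : (0 < n)%N by lia.
have xn (x : F) : x != 0 -> (x ^+ n) ^+ 2 = 1.
  move=> x0; apply: (mulfI x0); rewrite -exprM muln2 -exprS -FE mulr1; exact: expf_card.
have N1 : (-1 : F) != 1 by rewrite -subr_eq0 -opprD oppr_eq0.
rewrite /chi4 oF -/n; have [on|en] := boolP (odd n).
  rewrite eq_card0 => [|t]; first by rewrite -signr_odd on /= expr1 addrC subrr.
  rewrite !inE; apply/negP => /eqP t2.
  have t0 : t != 0.
    by apply/eqP => t0; move: t2; rewrite t0 expr0n /= => /esym/eqP; rewrite oppr_eq0 oner_eq0.
  (* Here [1 = (t ^+ n) ^+ 2 = (t ^+ 2) ^+ n = (-1) ^+ n = -1], a contradiction. *)
  by move: (xn _ t0) => /eqP; rewrite -exprM mulnC exprM t2 -signr_odd on expr1 (negPf N1).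
have [t t2] : exists t : F, t ^+ 2 = -1.
  (* ['X^n - 1] has at most [n] roots, fewer than the [2 n] nonzero elements. Some [x] thus has
     [x ^+ n = -1], and [x ^+ n./2] is the root sought. *)
  have /existsP[x /andP[x0 xn1]] : [exists x : F, (x != 0) && (x ^+ n != 1)].
    rewrite -[X in is_true X]negbK negb_exists; apply/negP => /forallP H.
    have := @max_poly_roots F ('X^n - 1) (enum (predC1 (0 : F))).
    rewrite -size_poly_eq0 size_Xn_sub_1 // => /(_ isT); rewrite enum_uniq.
    rewrite -cardE cardC1 FE /= => H2.
    have : (n.*2 < n.+1)%N.
      apply: H2 => //; apply/allP => x; rewrite mem_enum inE => x0.
      by move: (H x); rewrite x0 /= negbK rootE !hornerE subr_eq0.
    lia.
  exists (x ^+ n./2); rewrite -exprM muln2 even_halfK //.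
  by apply/eqP; move/eqP: (xn _ x0); rewrite sqrf_eq1 (negPf xn1).
have -> : #|[pred t : F | t ^+ 2 == -1]| = #|[set t; - t]|.
  by apply: eq_card => s; rewrite !inE -t2 eqf_sqr.
rewrite cards2 -signr_odd (negPf en) /= -subr_eq0 opprK -mulr2n -mulr_natl mulf_eq0 (negPf two0) /=.
suff -> : t != 0 by [].
by apply/eqP => t0; move: t2; rewrite t0 expr0n /= => /esym/eqP; rewrite oppr_eq0 oner_eq0.
Qed.

(** * Solutions modulo composite moduli: Chinese remainders and lifting *)

Lemma eqr_nat_Zp r a b : (1 < r)%N -> (a%:R == b%:R :> 'Z_r) = (a == b %[mod r])%N.
Proof. by move=> r1; rewrite -val_eqE /= !val_Zp_nat. Qed.

Lemma N2_Zp m r : (1 < r)%N ->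
  N2 m r = #|[pred p : 'Z_r * 'Z_r | p.1 ^+ 2 + p.2 ^+ 2 == m%:R]|.
Proof.
case: r => [|[|n]] // r1; apply: eq_card => -[x y].
by rewrite [LHS]inE -eqr_nat_Zp // natrD !natrX !natr_Zp inE.
Qed.

(** This form allows the exchange of summations in [N2_lift] and the direct evaluation of small
    cases. *)
Lemma N2_sum m r :
  N2 m r = (\sum_(0 <= x < r) \sum_(0 <= y < r) (x ^ 2 + y ^ 2 == m %[mod r]))%N.
Proof.
rewrite /N2 -sum1_card big_mkcond /= big_mkord.
under [RHS]eq_bigr do rewrite big_mkord.
rewrite pair_bigA /=; apply: eq_bigr => -[x y] _; rewrite inE /=.
by case: eqP.
Qed.

(** The Chinese remainder theorem in each coordinate gives a bijection [h], under which the solution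
    set is the preimage of the product of the two solution sets. *)
Lemma N2M m r s : (0 < r)%N -> (0 < s)%N -> coprime r s ->
  N2 m (r * s) = (N2 m r * N2 m s)%N.
Proof.
move=> r0 s0 co.
pose red k (k0 : (0 < k)%N) (x : nat) : 'I_k := Ordinal (ltn_pmod x k0).
pose h (p : 'I_(r * s) * 'I_(r * s)) :=
  ((red _ r0 p.1, red _ r0 p.2), (red _ s0 p.1, red _ s0 p.2)).
have h_inj : injective h.
  move=> [x y] [x' y'] /= [] xr yr xs ys.
  congr (_, _); apply: val_inj => /=.
    have /eqP := chinese_remainder co x x'.
    by rewrite xr xs !eqxx /= !modn_small // => /eqP/eqP.
  have /eqP := chinese_remainder co y y'.
  by rewrite yr ys !eqxx /= !modn_small // => /eqP/eqP.
have h_bij : bijective h.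
  by apply: inj_card_bij; rewrite // !card_prod !card_ord; lia.
rewrite -cardsX -(on_card_preimset (f := h)); last exact: onW_bij.
apply: eq_card => -[x y]; rewrite !inE /= chinese_remainder //.
have e k (a b : nat) : ((a %% k) ^ 2 + (b %% k) ^ 2 = a ^ 2 + b ^ 2 %[mod k])%N.
  by rewrite -modnDm !modnXm modnDm.
by rewrite !e.
Qed.

Lemma N2_mod m m' r : (m = m' %[mod r])%N -> N2 m r = N2 m' r.
Proof. by move=> e; apply: eq_card => p; rewrite !inE /= e. Qed.

(** As [l] is a unit modulo [r], scaling both coordinates by [l] is injective and carries solutions
    for [m] onto solutions for [l ^ 2 * m]. *)
Lemma N2_scale l m r : (1 < r)%N -> coprime r l -> N2 (l ^ 2 * m) r = N2 m r.
Proof.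
move=> r1 co; rewrite !N2_Zp //.
have ul : (l%:R : 'Z_r) \is a GRing.unit by rewrite unitZpE.
pose h (p : 'Z_r * 'Z_r) := (l%:R * p.1, l%:R * p.2).
have h_inj : injective h.
  by move=> [x y] [x' y'] e; congr (_, _); apply: (mulrI ul);
    [exact: (congr1 fst e) | exact: (congr1 snd e)].
rewrite -[RHS](fintype.card_image h_inj); apply: eq_card => -[x y]; rewrite !inE /=.
apply/idP/fintype.imageP => [/eqP e|[[x' y']]]; last first.
  rewrite inE /= => /eqP e [-> ->].
  by rewrite natrM natrX -e; apply/eqP; ring.
exists (l%:R^-1 * x, l%:R^-1 * y); rewrite /h /= ?mulVKr //.
rewrite inE /= !exprMn -mulrDr e natrM natrX mulrA -exprMn mulVr // expr1n mul1r.
by [].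
Qed.

Lemma sum_periodic r p (psi : nat -> nat) :
  (\sum_(0 <= x < r * p) psi (x %% r) = p * \sum_(0 <= x < r) psi x)%N.
Proof.
elim: p => [|p IHp]; first by rewrite muln0 big_nil.
rewrite (big_cat_nat (n := (r * p)%N)) ?leq_mul //= IHp mulSn addnC.
congr (_ + _)%N; rewrite -{1}[(r * p)%N]add0n big_addn -mulnBr subSnn muln1.
by apply: eq_big_nat => x /andP[_ xr]; rewrite addnC [(r * p)%N]mulnC modnMDl modn_small.
Qed.

(** The residue 1 modulo [r] has the [p] distinct lifts [1 + c * r] modulo [r * p]; if [s] is
    congruent to 1 modulo [r], it meets only the one with [c = (s %% (r * p)) %/ r]. *)
Lemma sum_residue_lifts r p s : (1 < r)%N -> (0 < p)%N ->
  (\sum_(0 <= c < p) (s == 1 + c * r %[mod r * p]) = (s == 1 %[mod r]))%N.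
Proof.
move=> r1 p0; set t := (s %% (r * p))%N.
have tr : (t < r * p)%N by rewrite ltn_mod muln_gt0 p0 (ltnW r1).
have -> : (s %% r)%N = (t %% r)%N by rewrite /t modn_dvdm // dvdn_mulr.
have c0p : (t %/ r < p)%N by rewrite ltn_divLR ?(ltnW r1) // mulnC.
rewrite (bigD1_seq (t %/ r)%N) ?iota_uniq ?mem_index_iota //= big1_seq => [|c].
  rewrite addn0; congr nat_of_bool; rewrite [(1 %% r)%N]modn_small //.
  have lt : (1 + t %/ r * r < r * p)%N by move: c0p; set q := (t %/ r)%N; nia.
  by rewrite (modn_small lt) {1}(divn_eq t r) addnC eqn_add2r.
rewrite mem_index_iota => /and3P[cn _ cp]; apply/eqP; rewrite eqb0.
apply: contra cn => /eqP ->; rewrite modn_small; last by nia.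
by rewrite addnC divnMDl ?(ltnW r1) // divn_small // addn0.
Qed.

(* Multiplication by a square root of [1 + c r] identifies the solutions modulo [r p]
   of [x^2 + y^2 = 1] with those of [x^2 + y^2 = 1 + c r], so the lifts of the
   solutions modulo [r] are equidistributed among the [p] classes. *)
Lemma N2_lift r p : (1 < r)%N -> (0 < p)%N -> (p %| r)%N ->
    (forall c, (c < p)%N -> exists l, (l ^ 2 = 1 + c * r %[mod r * p])%N) ->
  N2 1 (r * p) = (p * N2 1 r)%N.
Proof.
move=> r1 p0 pr sq.
have rp1 : (1 < r * p)%N by rewrite (leq_trans r1) ?leq_pmulr.
have E c : (c < p)%N -> N2 (1 + c * r) (r * p) = N2 1 (r * p).
  move=> cp; have [l l2] := sq _ cp; rewrite -(N2_mod l2) -[(l ^ 2)%N]muln1.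
  apply: N2_scale => //.
  (* Modulo [r] the square of [l] is 1, so [l] is prime to [r], hence also to the divisor [p] of
     [r]. *)
  have col : coprime r l.
    rewrite -(@coprime_pexpr 2) // -coprime_modr.
    have -> : (l ^ 2 %% r = 1 %% r)%N.
      by rewrite -(modn_dvdm _ (dvdn_mulr p (dvdnn r))) l2 modn_dvdm ?dvdn_mulr // addnC modnMDl.
    by rewrite coprime_modr coprimen1.
  by rewrite coprimeMl col (coprime_dvdl pr).
apply/eqP; rewrite -(eqn_pmul2l p0); apply/eqP.
(* Double counting over all [c]: the [p] equal counts add up to the number of pairs modulo [r * p]
   that solve the congruence modulo [r] only. *)
transitivity (\sum_(0 <= c < p) N2 (1 + c * r) (r * p))%N.
  by rewrite big_mkord (eq_bigr _ (fun (c : 'I_p) _ => E c (ltn_ord c))) sum_nat_const card_ord.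
under eq_bigr do rewrite N2_sum.
rewrite exchange_big /=.
under eq_bigr do rewrite exchange_big /=.
under eq_bigr => x _ do under eq_bigr => y _ do rewrite sum_residue_lifts //.
have e x y : (x ^ 2 + y ^ 2 == 1 %[mod r])%N =
    ((x %% r) ^ 2 + (y %% r) ^ 2 == 1 %[mod r])%N.
  by rewrite -[in RHS]modnDm !modnXm modnDm.
(* The condition has period [r] in each variable, so each of the two sums contributes a factor
   [p]. *)
under eq_bigr => x _.
  under eq_bigr => y _ do rewrite e.
  rewrite (@sum_periodic r p (fun y => ((x %% r) ^ 2 + y ^ 2 == 1 %[mod r]) : nat)).
  over.
rewrite -big_distrr /= (@sum_periodic r p (fun x => \sum_(0 <= y < r) (x ^ 2 + y ^ 2 == 1 %[mod r])))%N.
by rewrite -N2_sum.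
Qed.

Lemma N2_1_2 : N2 1 2 = 2%N.
Proof. by rewrite N2_sum unlock. Qed.

Lemma N2_1_4 : N2 1 4 = 8%N.
Proof. by rewrite N2_sum unlock. Qed.

Lemma N2_1_8 : N2 1 8 = 16%N.
Proof. by rewrite N2_sum unlock. Qed.

(** By the two counts over ['F_p], the number of solutions plus [1 + chi4 p] is [p + 1]. *)
Lemma N2_1_prime p : prime p -> odd p -> (N2 1 p)%:Z = p%:Z - chi4 p.
Proof.
move=> pp op; have p2 : (2 < p)%N by rewrite odd_prime_gt2.
have two0 : (2 : 'F_p) != 0.
  by rewrite -(dvdn_pcharf (pchar_Fp pp)) gtnNdvd.
have := card_circle_finField two0; have := @card_sqrtN1_finField 'F_p.
rewrite card_Fp // => /(_ op two0).
have -> : N2 1 p = #|[pred q : 'F_p * 'F_p | q.1 ^+ 2 + q.2 ^+ 2 == 1]|.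
  by rewrite -{1}(pdiv_id pp) N2_Zp // pdiv_id // prime_gt1.
set a := #|_|; set b := #|_| => e1 e2; have : (b + a = p.+1)%N := e2.
lia.
Qed.

Lemma N2_1_odd_pfactor p k : prime p -> odd p ->
  (N2 1 (p ^ k.+1))%:Z = circle_count (p ^ k.+1).
Proof.
move=> pp op; elim: k => [|k IHk].
  by rewrite circle_count_pfactor // expn0 expn1 mul1r N2_1_prime // natz.
rewrite expnSr N2_lift ?prime_gt0 ?dvdn_exp //.
- by rewrite PoszM IHk -expnSr !circle_count_pfactor // expnS natrM !natz mulrA.
- by rewrite -[X in (X < _)%N](expn0 p) ltn_exp2l ?prime_gt1.
(* The factor [p.+1./2] is the inverse of 2 modulo [p], so the cross term of the square is
   [c * p ^ k.+1] modulo [p ^ k.+2]. *)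
move=> c _; exists (1 + p.+1./2 * c * p ^ k.+1)%N.
set h := p.+1./2; have hE : (h * 2 = p + 1)%N by rewrite muln2 /h addn1 even_halfK //= op.
have -> : ((1 + h * c * p ^ k.+1) ^ 2 =
   (c + h ^ 2 * c ^ 2 * p ^ k) * (p ^ k.+1 * p) + (1 + c * p ^ k.+1))%N.
  have -> : ((1 + h * c * p ^ k.+1) ^ 2 =
    1 + (h * 2) * c * p ^ k.+1 + h ^ 2 * c ^ 2 * p ^ k.+1 * p ^ k.+1)%N by ring.
  by rewrite hE expnS; ring.
by rewrite modnMDl.
Qed.

Lemma N2_1_pow2 k : N2 1 (2 ^ k.+2) = (2 ^ k.+3)%N.
Proof.
(* The cases 4 and 8 are evaluated directly: the lift from 4 to 8 would need a square root of 5
   modulo 8. Lifting starts at 8. *)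
elim: k => [|[|k] IHk]; rewrite ?N2_1_4 ?N2_1_8 // expnSr N2_lift //.
- by rewrite IHk -expnS.
- by rewrite -[X in (X < _)%N](expn0 2) ltn_exp2l ?prime_gt1.
- exact: dvdn_exp.
move=> [|[|//]] _; first by exists 1%N; rewrite mul0n addn0.
(* The cross term is [2 ^ k.+3], and the last term [2 ^ (2 * k + 4)] vanishes modulo [2 ^ k.+4]. *)
exists (1 + 2 ^ k.+2)%N; rewrite mul1n.
have -> : ((1 + 2 ^ k.+2) ^ 2 = 2 ^ k * (2 ^ k.+3 * 2) + (1 + 2 ^ k.+3))%N.
  by rewrite !expnS; ring.
by rewrite modnMDl.
Qed.

(** Both sides are multiplicative, so it suffices to compare them at prime powers. *)
Lemma N2_1_circle_count r : (0 < r)%N ->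
  (N2 1 r)%:Z = (if 4 %| r then 2 else 1)%N%:Z * circle_count r.
Proof.
pose c r := (if (4 %| r)%N then 2 else 1)%N%:Z.
have N2_11 : N2 1 1 = 1%N by rewrite N2_sum unlock.
have Nmult : arith_multiplicative (fun r => (N2 1 r)%:Z).
  by split=> [|m n m0 n0 co]; rewrite ?N2_11 // N2M // PoszM.
have cmult : arith_multiplicative (fun r => c r * circle_count r).
  split=> [|m n m0 n0 co]; first by rewrite (proj1 circle_count_multiplicative).
  rewrite (proj2 circle_count_multiplicative) // mulrACA; congr (_ * _).
  have odd4 k : odd k -> (4 %| k)%N = false by lia.
  (* One of two coprime factors is odd, and then 4 divides the product exactly when it divides the
     other factor. *)
  have [om|em] := boolP (odd m).
    by rewrite /c Gauss_dvdr ?(odd4 m) ?mul1r // (@coprime_pexpl 2 2) // coprime2n.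
  have on : odd n.
    rewrite -coprime2n; apply: coprime_dvdl co; by rewrite dvdn2.
  by rewrite /c mulnC Gauss_dvdr ?(odd4 n) ?mulr1 // (@coprime_pexpl 2 2) // coprime2n.
move=> r0; apply: (multiplicative_ext Nmult cmult) => // p [//|k] pp _.
have [op|ep] := boolP (odd p).
  rewrite N2_1_odd_pfactor // /c; suff -> : (4 %| p ^ k.+1)%N = false by rewrite mul1r.
  have : odd (p ^ k.+1) by rewrite oddX op orbT.
  lia.
have {pp ep} -> : p = 2%N by case/even_prime: pp ep => // ->.
rewrite circle_count_pfactor // subr0 /c; case: k => [|k]; first by rewrite expn1 N2_1_2.
rewrite N2_1_pow2 (@dvdn_exp2l 2 2 k.+2) //.
by rewrite !natz -!PoszM -expnSr -expnS.
Qed.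

(** * The alternating series of the Catalan constant *)

(** Peeling off the first term writes the sum as [a j] minus the sum started at [j.+1], which lies
    between 0 and [a j.+1]; hence the general start [j]. *)
Lemma alternating_sum_bounds (R : numDomainType) (a : nat -> R) m j :
    (forall n, 0 <= a n) -> (forall n, a n.+1 <= a n) ->
  0 <= \sum_(i < m) (-1) ^+ i * a (j + i)%N <= a j.
Proof.
move=> a0 a_decr; elim: m j => [|m IHm] j; first by rewrite big_ord0 lexx a0.
rewrite big_ord_recl expr0 mul1r addn0.
under eq_bigr do rewrite lift0 exprS mulN1r mulNr -addSnnS.
have /andP[lo hi] := IHm j.+1; rewrite sumrN subr_ge0 (le_trans hi (a_decr j)) /=.
by rewrite gerBl.
Qed.

Local Open Scope classical_set_scope.

Definition catalan_term (R : realType) (n : nat) : R :=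
  (-1) ^+ n / (2 * n + 1)%:R ^+ 2.

Lemma catalan_sum_bound (R : realType) j m :
  `|\sum_(j <= k < m) catalan_term R k| <= ((2 * j + 1)%:R ^+ 2)^-1.
Proof.
pose a (n : nat) : R := ((2 * n + 1)%:R ^+ 2)^-1.
have a0 n : 0 <= a n by rewrite invr_ge0 exprn_ge0.
have a_decr n : a n.+1 <= a n.
  by rewrite lef_pV2 ?posrE ?exprn_gt0 ?ltr0n ?addn1 // lerXn2r ?nnegrE // ler_nat; lia.
have [mj|jm] := leqP m j; first by rewrite big_geq // normr0 a0.
have /andP[lo hi] := alternating_sum_bounds (m - j) j a0 a_decr.
have -> : \sum_(j <= k < m) catalan_term R k =
          (-1) ^+ j * \sum_(i < m - j) (-1) ^+ i * a (j + i)%N.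
  rewrite -{1}[j]add0n big_addn big_mkord mulr_sumr; apply: eq_bigr => i _.
  by rewrite /catalan_term addnC exprD /a mulrA.
by rewrite normrM normrX normrN1 expr1n mul1r ger0_norm.
Qed.

Lemma is_cvg_catalan (R : realType) : cvgn (series (catalan_term R)).
Proof.
apply/cauchy_cvgP/cauchy_seriesP => e e0.
(* For [j >= N] one has [(2 * j + 1) ^ 2 >= N + 1 > e^-1]. *)
pose N := Num.truncn e^-1.
exists ([set n | (N <= n)%N], [set n | (N <= n)%N]).
  by split; exists N.
move=> [j m] /= [Nj _]; apply: le_lt_trans (catalan_sum_bound R j m) _.
rewrite invf_plt ?posrE ?exprn_gt0 ?ltr0n ?addn1 //.
have eN : e^-1 < N.+1%:R by rewrite real_truncnS_gt // num_real.
apply: lt_le_trans eN _; rewrite -natrX ler_nat.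
nia.
Qed.

Lemma catalan_tail (R : realType) j :
  `|catalan R - series (catalan_term R) j| <= ((2 * j + 1)%:R ^+ 2)^-1.
Proof.
have cv : (fun m => `|series (catalan_term R) m - series (catalan_term R) j|) @ \oo -->
    `|catalan R - series (catalan_term R) j|.
  by apply: cvg_norm; apply: cvgB; [exact: is_cvg_catalan | exact: cvg_cst].
rewrite -(cvg_lim _ cv) //; apply: limr_le; first by apply/cvg_ex; eexists; exact: cv.
near=> m; rewrite sub_series.
have jm : (j <= m)%N by near: m; exists j.
by rewrite jm catalan_sum_bound.
Unshelve. all: by end_near. Qed.

(** Even [n] contribute 0, and there are [uphalf k] odd numbers up to [k]. *)
Lemma chi4_series (R : realType) k :
  \sum_(1 <= n < k.+1) (chi4 n)%:~R / n%:R ^+ 2 =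
  series (catalan_term R) (uphalf k).
Proof.
elim: k => [|k IHk]; first by rewrite big_nil /series /= big_nil.
rewrite big_nat_recr // IHk.
have [j [->|->]] : exists j, k = (2 * j)%N \/ k = (2 * j).+1.
  by exists k./2; lia.
- rewrite (_ : uphalf (2 * j) = j) 1?(_ : uphalf (2 * j).+1 = j.+1); [|lia..].
  rewrite seriesSr; congr (_ + _).
  have -> : chi4 (2 * j).+1 = (-1) ^+ j.
    by rewrite /chi4; rewrite ifT; [congr (_ ^+ _) | ]; lia.
  by rewrite rmorphXn rmorphN1 /catalan_term addn1.
rewrite (_ : uphalf (2 * j).+1 = j.+1) 1?(_ : uphalf (2 * j).+2 = j.+1); [|lia..].
have -> : chi4 (2 * j).+2 = 0 by rewrite /chi4; case: ifP => //; lia.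
by rewrite mulr0z mul0r; exact: addr0.
Qed.

Lemma chi4_series_tail (R : realType) k :
  `|catalan R - \sum_(1 <= n < k.+1) (chi4 n)%:~R / n%:R ^+ 2| <= (k.+1%:R ^+ 2)^-1.
Proof.
rewrite chi4_series (le_trans (catalan_tail R _)) //.
rewrite lef_pV2 ?posrE ?exprn_gt0 ?ltr0n ?addn1 // lerXn2r ?nnegrE // ler_nat.
lia.
Qed.

(** The tail bound after the single term 1. It makes the constant positive and [(2 * catalan R)^-1]
    at most 1 in the estimates below. *)
Lemma catalan_ge (R : realType) : 3 / 4 <= catalan R.
Proof.
have := chi4_series_tail R 1; rewrite big_nat1 /chi4 /= expr1n divr1 ler_norml.
have -> : ((2 : R) ^+ 2)^-1 = 1 / 4 by field.
by move=> /andP[+ _]; lra.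
Qed.

(** * The partial sums of [f(d) / d^2] *)

Lemma normr_chi4_invr_le1 (R : realType) d : `|(chi4_inv d)%:~R : R| <= 1.
Proof. by rewrite -intr_norm -[1]/(1%:~R) ler_int normr_chi4_inv_le1. Qed.

Lemma sum_chi4_inv_chi4 (R : realType) M : (0 < M)%N ->
  \sum_(1 <= d < M.+1) ((chi4_inv d)%:~R : R) / d%:R ^+ 2 *
    (\sum_(1 <= n < (M %/ d).+1) (chi4 n)%:~R / n%:R ^+ 2) = 1.
Proof.
move=> M0.
under eq_bigr do rewrite mulr_sumr.
rewrite -(sum_divisors_hyperbola
  (fun d n => (chi4_inv d)%:~R / d%:R ^+ 2 * ((chi4 n)%:~R / n%:R ^+ 2))).
transitivity (\sum_(1 <= n < M.+1) (n == 1%N)%:R / n%:R ^+ 2 : R).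
  apply: eq_big_nat => n /andP[n0 _].
  have -> : (n == 1%N)%:R = (dirichlet chi4_inv chi4 n)%:~R :> R.
    by rewrite dirichlet_chi4_inv // rmorph_nat.
  rewrite /dirichlet rmorph_sum mulr_suml; apply: eq_big_seq => d /=.
  rewrite -dvdn_divisors // => /divnK; set q := (n %/ d)%N => <-.
  by rewrite rmorphM natrM exprMn mulf_div [X in _ / X]mulrC.
rewrite big_nat_recl // eqxx expr1n divr1 big_nat big1 ?addr0 // => n /andP[n0 _].
by case: eqP => [|_]; [lia|rewrite mul0r].
Qed.

(** By the preceding identity, [1 - G F] is the sum of [f(d) / d^2] times the tail of the inner
    series beyond [M %/ d]. The tail is at most [d^2 / M^2], so each of the [M] terms is at most
    [1 / M^2]. *)
Lemma sum_chi4_inv_bound (R : realType) M : (0 < M)%N ->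
  `|(catalan R)^-1 - \sum_(1 <= d < M.+1) ((chi4_inv d)%:~R : R) / d%:R ^+ 2|
    <= (catalan R * M%:R)^-1.
Proof.
move=> M0; have G := catalan_ge R; have G0 : 0 < catalan R by lra.
set F := \sum_(_ <= _ < _) _.
have -> : (catalan R)^-1 - F = (catalan R)^-1 * (1 - catalan R * F).
  by field; rewrite gt_eqF.
rewrite normrM gtr0_norm ?invr_gt0 // invfM ler_pM2l ?invr_gt0 //.
rewrite distrC -[X in `|_ - X|](sum_chi4_inv_chi4 R M0) /F mulr_sumr -sumrB.
apply: le_trans (ler_norm_sum _ _ _) _.
have -> : M%:R^-1 = \sum_(1 <= d < M.+1) (M%:R ^+ 2)^-1 :> R.
  by rewrite sumr_const_nat subn1 -[_ *+ _]mulr_natl; field; rewrite pnatr_eq0 -lt0n.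
rewrite big_nat [leRHS]big_nat; apply: ler_sum => d /andP[d0 dM].
have d0' : (0 : R) < d%:R by rewrite ltr0n.
rewrite [catalan R * _]mulrC -mulrBr normrM normrM normfV [`|_ ^+ 2|]ger0_norm ?exprn_ge0 //.
apply: le_trans (_ : 1 / d%:R ^+ 2 * ((M %/ d).+1%:R ^+ 2)^-1 <= _).
  rewrite ler_pM ?mulr_ge0 ?invr_ge0 ?exprn_ge0 ?chi4_series_tail //.
  by rewrite ler_pM2r ?invr_gt0 ?exprn_gt0 ?normr_chi4_invr_le1.
rewrite mul1r -invfM -exprMn lef_pV2 ?posrE ?exprn_gt0 ?mulr_gt0 ?ltr0n //.
rewrite lerXn2r ?nnegrE // -natrM ler_nat.
(* This is [M < d * (M %/ d).+1]. *)
by rewrite mulnC ltnW // ltn_ceil.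
Qed.

(** * The summatory function [S] of [g] *)

(** As [y - 1 < k <= y], the value [k (k + 1) / 2] lies between [y (y - 1) / 2] and
    [y (y + 1) / 2]. *)
Lemma triangular_bound (R : realType) (y : R) k : 1 <= y -> k%:R <= y < k.+1%:R ->
  `|\sum_(1 <= m < k.+1) m%:R - y ^+ 2 / 2| <= y.
Proof.
have -> : \sum_(1 <= m < k.+1) m%:R = k%:R * (k%:R + 1) / 2 :> R.
  elim: k => [|k IHk]; first by rewrite big_nil mul0r mul0r.
  by rewrite big_nat_recr //= IHk -natr1; field.
rewrite -natr1 => y1 /andP[ky yk]; have k0 : (0 : R) <= k%:R by [].
by rewrite ler_norml; apply/andP; split; nra.
Qed.

(** The increment is bounded by [ln (1 - v) <= - v] at [v = 1 / (M + 2)], where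
    [1 - v = (M + 1) / (M + 2)]. *)
Lemma harmonic_bound (R : realType) M : (0 < M)%N ->
  \sum_(1 <= d < M.+1) d%:R^-1 <= 1 + ln M%:R :> R.
Proof.
case: M => // M _; elim: M => [|M IHM]; first by rewrite big_nat1 invr1 ln1 addr0.
rewrite big_nat_recr //=; apply: le_trans (lerD IHM (lexx _)) _.
rewrite -addrA lerD2l.
have M1 : (0 : R) < M.+1%:R by rewrite ltr0n.
have M2 : (0 : R) < M.+2%:R by rewrite ltr0n.
have : ln (1 + - M.+2%:R^-1) <= - M.+2%:R^-1 :> R.
  by apply: le_ln1Dx; rewrite ltrN2 invf_lt1 // ltr1n.
have -> : 1 + - M.+2%:R^-1 = M.+1%:R / M.+2%:R :> R.
  by rewrite -[M.+1%:R](addrK 1) natr1 mulrBl mul1r divff ?gt_eqF.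
rewrite ln_div ?posrE //.
by move: (ln _) (ln _) (_^-1) => a b v; lra.
Qed.

Definition circle_sum (R : realType) M : R := \sum_(1 <= n < M.+1) (circle_count n)%:~R.

Lemma circle_sumE (R : realType) M :
  circle_sum R M = \sum_(1 <= d < M.+1) (chi4_inv d)%:~R * \sum_(1 <= m < (M %/ d).+1) m%:R.
Proof.
under eq_bigr do rewrite mulr_sumr.
rewrite -(sum_divisors_hyperbola (fun d n => (chi4_inv d)%:~R * n%:R)).
apply: eq_bigr => n _; rewrite rmorph_sum; apply: eq_bigr => d _ /=.
by rewrite rmorphM /= natz.
Qed.

Lemma circle_sum_bound (R : realType) M : (0 < M)%N ->
  `|circle_sum R M - M%:R ^+ 2 / (2 * catalan R)| <= M%:R * (2 + ln M%:R).
Proof.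
move=> M0; have M0' : (0 : R) < M%:R by rewrite ltr0n.
have G := catalan_ge R; have G0 : 0 < catalan R by lra.
set F := \sum_(1 <= d < M.+1) ((chi4_inv d)%:~R : R) / d%:R ^+ 2.
(* Each inner sum is replaced by [(M / d)^2 / 2] at a cost of [M / d], and these costs form a
   harmonic sum. *)
have A1 : `|circle_sum R M - M%:R ^+ 2 / 2 * F| <= M%:R * (1 + ln M%:R).
  rewrite circle_sumE /F mulr_sumr -sumrB.
  apply: le_trans (ler_norm_sum _ _ _) _.
  apply: le_trans (_ : \sum_(1 <= d < M.+1) M%:R * d%:R^-1 <= _); last first.
    by rewrite -mulr_sumr ler_pM2l // harmonic_bound.
  rewrite big_nat [leRHS]big_nat; apply: ler_sum => d /andP[d0 dM].
  have d0' : (0 : R) < d%:R by rewrite ltr0n.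
  have -> : (M%:R : R) ^+ 2 / 2 * ((chi4_inv d)%:~R / d%:R ^+ 2) =
    (chi4_inv d)%:~R * ((M%:R / d%:R) ^+ 2 / 2).
    by field; rewrite gt_eqF.
  rewrite -mulrBr normrM; apply: le_trans (_ : 1 * (M%:R / d%:R) <= _); last by rewrite mul1r.
  apply: ler_pM => //; first exact: normr_chi4_invr_le1.
  apply: triangular_bound; first by rewrite ler_pdivlMr // mul1r ler_nat.
  rewrite ler_pdivlMr // ltr_pdivrMr // -!natrM ler_nat ltr_nat leq_divM /=.
  exact: ltn_ceil.
(* Replacing [F] by [1 / G] costs [M^2 / 2 * 1 / (G M) = M / (2 G)], at most [M]. *)
have A2 : `|M%:R ^+ 2 / 2 * F - M%:R ^+ 2 / (2 * catalan R)| <= M%:R.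
  have -> : M%:R ^+ 2 / 2 * F - M%:R ^+ 2 / (2 * catalan R) =
            - (M%:R ^+ 2 / 2 * ((catalan R)^-1 - F)) by field; rewrite gt_eqF.
  rewrite normrN normrM ger0_norm ?mulr_ge0 ?exprn_ge0 ?invr_ge0 //.
  apply: le_trans (ler_wpM2l _ (sum_chi4_inv_bound R M0)) _.
    by rewrite mulr_ge0 ?exprn_ge0 ?invr_ge0.
  have -> : M%:R ^+ 2 / 2 * (catalan R * M%:R)^-1 = M%:R * (2 * catalan R)^-1.
    by field; rewrite !gt_eqF.
  rewrite ger_pMr // invf_le1; lra.
have -> : circle_sum R M - M%:R ^+ 2 / (2 * catalan R) =
  (circle_sum R M - M%:R ^+ 2 / 2 * F) + (M%:R ^+ 2 / 2 * F - M%:R ^+ 2 / (2 * catalan R)) by ring.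
apply: le_trans (ler_normD _ _) _; apply: le_trans (lerD A1 A2) _.
by rewrite le_eqVlt; apply/orP; left; apply/eqP; ring.
Qed.

(** * Assembling the asymptotic formula *)

Lemma sum_multiples (V : nmodType) (F : nat -> V) k M : (0 < k)%N ->
  \sum_(1 <= n < M.+1 | (k %| n)%N) F n = \sum_(1 <= n < (M %/ k).+1) F (k * n)%N.
Proof.
move=> k0; elim: M => [|M IHM]; first by rewrite div0n !big_nil.
rewrite big_mkcond big_nat_recr // -big_mkcond IHM divnS //=.
case: ifP => [dv|_]; last exact: addr0.
rewrite add1n [RHS]big_nat_recr //; congr (_ + F _).
by rewrite -[LHS](divnK dv) divnS // dv mulnC.
Qed.

(** The factor 2 at multiples of 4 is split as [1 + 1]; the second summand runs over [r = 4 s],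
    where [g(4 s) = 4 g(s)]. *)
Lemma sum_N2_circle_sum (R : realType) (x : R) :
  sum_N2 1 x = circle_sum R (Num.truncn x) + 4 * circle_sum R (Num.truncn x %/ 4).
Proof.
rewrite /sum_N2 /circle_sum; set M := Num.truncn x; rewrite natr_sum mulr_sumr.
transitivity (\sum_(1 <= n < M.+1) ((circle_count n)%:~R +
    (if (4 %| n)%N then (circle_count n)%:~R else 0)) : R).
  apply: eq_big_nat => n /andP[n0 _].
  have -> : (N2 1 n)%:R = ((N2 1 n)%:Z)%:~R :> R by [].
  by rewrite N2_1_circle_count //; case: ifP => _; rewrite rmorphM /=; ring.
rewrite big_split /= -big_mkcond sum_multiples //; congr (_ + _).
by apply: eq_big_nat => n /andP[n0 _]; rewrite circle_count4 // rmorphM.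
Qed.

Lemma sum_N2_bound (R : realType) (x : R) : 4 <= x ->
  `|sum_N2 1 x - 5 / (8 * catalan R) * x ^+ 2| <= 8 * x + 2 * (x * ln x).
Proof.
move=> x4; rewrite sum_N2_circle_sum.
have G := catalan_ge R; have G0 : 0 < catalan R by lra.
have /andP[Mx xM] := @truncn_itv R x (le_trans (ler0n R 4) x4).
set M := Num.truncn x in Mx xM *.
have M4 : (4 <= M)%N by rewrite -(ltr_nat R) in xM *; lra.
(* The assumption [4 <= x] makes [q] positive, so [circle_sum_bound] applies to it. *)
set q := (M %/ 4)%N; have q0 : (0 < q)%N by rewrite divn_gt0.
have M0 : (0 < M)%N by exact: leq_trans M4.
have qM : (4 * q <= M)%N by lia.
have Mq : (M <= 4 * q + 3)%N by lia.
have q0' : (0 : R) < q%:R by rewrite ltr0n.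
have M0' : (0 : R) < M%:R by rewrite ltr0n.
have {}qM : 4 * q%:R <= M%:R :> R by rewrite -natrM ler_nat.
have {}Mq : M%:R <= 4 * q%:R + 3 :> R by rewrite -natrM -natrD ler_nat.
have lnMx : ln M%:R <= ln x by rewrite ler_ln ?posrE //; lra.
have lnqx : ln q%:R <= ln x by rewrite ler_ln ?posrE //; lra.
have lnq0 : 0 <= ln q%:R :> R by rewrite ln_ge0 // ler1n.
have lnM0 : 0 <= ln M%:R :> R by rewrite ln_ge0 // ler1n.
rewrite -natr1 in xM.
have bM : `|circle_sum R M - M%:R ^+ 2 / (2 * catalan R)| <= x * (2 + ln x).
  apply: le_trans (circle_sum_bound R M0) _.
  by apply: ler_pM; lra.
have bq : `|4 * (circle_sum R q - q%:R ^+ 2 / (2 * catalan R))| <= x * (2 + ln x).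
  rewrite normrM ger0_norm //.
  apply: le_trans (_ : 4 * (q%:R * (2 + ln q%:R)) <= _).
    by rewrite ler_pM2l // circle_sum_bound.
  by rewrite mulrA; apply: ler_pM; lra.
set H := (2 * catalan R)^-1 in bM bq.
have H1 : 0 <= H <= 1.
  by rewrite /H invr_ge0 invf_le1; lra.
have -> : 5 / (8 * catalan R) = 5 / 4 * H by rewrite /H; field; rewrite gt_eqF.
(* Rounding errors: [x - M < 1] and [x - 4 q < 4], so the two differences of squares are at most
   [2 x] and [8 x / 4] in absolute value. *)
have bd : `|M%:R ^+ 2 - x ^+ 2 + (4 * q%:R ^+ 2 - x ^+ 2 / 4)| <= 4 * x.
  have xM2 : (x - M%:R) * (x + M%:R) <= 1 * (2 * x) by apply: ler_pM; lra.
  have xq2 : (x - 4 * q%:R) * (x + 4 * q%:R) <= 4 * (2 * x) by apply: ler_pM; lra.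
  by rewrite ler_norml; apply/andP; split; nra.
have bd' : `|H * (M%:R ^+ 2 - x ^+ 2 + (4 * q%:R ^+ 2 - x ^+ 2 / 4))| <= 4 * x.
  rewrite normrM (ger0_norm (proj1 (andP H1))); apply: le_trans (bd).
  by rewrite ler_piMl // (proj2 (andP H1)).
have -> : circle_sum R M + 4 * circle_sum R q - 5 / 4 * H * x ^+ 2 =
  (circle_sum R M - M%:R ^+ 2 * H) + 4 * (circle_sum R q - q%:R ^+ 2 * H) +
  H * (M%:R ^+ 2 - x ^+ 2 + (4 * q%:R ^+ 2 - x ^+ 2 / 4)) by field.
apply: le_trans (ler_normD _ _) _.
apply: le_trans (lerD (ler_normD _ _) (lexx _)) _.
apply: le_trans (lerD (lerD bM bq) bd') _.
by rewrite le_eqVlt; apply/orP; left; apply/eqP; ring.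
Qed.

Theorem proposition36 (R : realType) :
  (fun x : R => sum_N2 1 x) =
  (fun x : R => 5 / (8 * catalan R) * x ^+ 2) +O_ +oo (fun x : R => x * ln x).
Proof.
(* Beyond [4 + e] one has [ln x >= 1], so [8 x + 2 x ln x] is at most [10 x ln x]. *)
apply/eqaddOP; exists 10; split; first exact: num_real.
move=> k k10; exists (4 + expR 1); split; first exact: num_real.
move=> x x_large.
have e0 := expR_gt0 (1 : R).
have lnx : 1 <= ln x.
  by rewrite -[leLHS](@expRK R) ler_ln ?posrE //; lra.
have x0 : 0 < x by lra.
apply: le_trans (sum_N2_bound _) _; first by lra.
rewrite ger0_norm; last by rewrite mulr_ge0 //; lra.
have : x <= x * ln x by rewrite ler_peMr // ltW.
have : 10 * (x * ln x) <= k * (x * ln x) by rewrite ler_pM2r ?ltW //; nra.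
lra.
Qed.
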